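(* Assume there are constants $m,M>0$, $p\ge1$, $\bar r>0$ such that $$m\,\mathrm{dist}(x,E(t))^p\le W(t,x)\le M\,\mathrm{dist}(x,E(t))^p$$ for all $(t,x)\in[t_0,\infty)\times\mathbb{R}^n$ with $\mathrm{dist}(x,E(t))\le\bar r$. Let $x(\cdot)$ be a solution of $\dot x(t)=f(t,x(t))$ on $[t_0,\infty)$ satisfying $$\frac{d}{dt}W(t,x(t))\le-\lambda W(t,x(t))+c\,(v_E(t)+\rho(t))^p\quad\text{for a.e. }t\ge t_0,$$ where $\lambda>0$, $c\ge0$, $\rho\in L^\infty([t_0,\infty))$ is nonnegative and $v_E\in L^\infty([t_0,\infty))$. Let $r\in(0,\bar r]$ and assume $$\Big(\frac{c}{m\lambda}\Big)^{1/p}\big(\|v_E\|_\infty+\|\rho\|_\infty\big)\le\frac r2,\qquad \mathrm{dist}(x(t_0),E(t_0))<\frac12\Big(\frac mM\Big)^{1/p}r.$$ Assume moreover that $v_E,\rho\in L^p([t_0,\infty))$, with the same exponent $p$. Then $\mathrm{dist}(x(t),E(t))\to0$ as $t\to\infty$.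
   Context: Fix $t_0\ge 0$ and $f:[t_0,\infty)\times\mathbb{R}^n\to\mathbb{R}^n$ such that $t\mapsto f(t,x)$ is measurable for every $x$ and $x\mapsto f(t,x)$ is locally Lipschitz for a.e. $t\ge t_0$. A solution is a locally absolutely continuous $x:[t_0,\infty)\to\mathbb{R}^n$ with $\dot x(t)=f(t,x(t))$ for a.e. $t\ge t_0$. For nonempty $S$, $\mathrm{dist}(x,S)=\inf_{y\in S}\|x-y\|$. The equilibrium sets are $E(t):=\{x\in\mathbb{R}^n: f(t,x)=0\}$, assumed nonempty and closed for every $t\ge t_0$. For nonempty closed $A,B$ and $R>0$, $d_R^{\rm AW}(A,B):=\sup_{\|z\|\le R}|\mathrm{dist}(z,A)-\mathrm{dist}(z,B)|$. Standing assumption: $v_E\in L^1_{\mathrm{loc}}([t_0,\infty))$ (the equilibrium speed) is nonnegative and for every $R>0$ and $t_0\le s\le t$, $d_R^{\rm AW}(E(t),E(s))\le\int_s^t v_E(\tau)\,d\tau$. The function $W:=V_1+\delta V_2$ ($\delta>0$ fixed) is built from $V_1,V_2:[0,\infty)\times\mathbb{R}^n\to[0,\infty)$ such that for every solution $x(\cdot)$ the maps $t\mapsto V_i(t,x(t))$ are locally absolutely continuous on $[t_0,\infty)$. $\|\cdot\|_\infty$ is the essential supremum norm over $[t_0,\infty)$. *)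

(* Defs.v *)
From HB Require Import structures.
From mathcomp Require Import all_boot all_order all_algebra.
From mathcomp Require Import all_classical all_reals all_analysis.

Set Implicit Arguments.
Unset Strict Implicit.
Unset Printing Implicit Defensive.

Import Order.TTheory GRing.Theory Num.Theory.
Import numFieldNormedType.Exports.

Local Open Scope classical_set_scope.
Local Open Scope ring_scope.

(* R^n is 'rV[R]_n.  A function of t in [t0, oo) is a total function on R of
   which only the values at t >= t0 are used. *)

Section Euclidean_distance.
Context {R : realType} {n : nat}.
Implicit Types (x z : 'rV[R]_n) (A B S : set 'rV[R]_n).

(* The library norm of 'rV[R]_n is the max norm; distances are Euclidean. *)
Definition enorm x : R := Num.sqrt (\sum_(j < n) x ord0 j ^+ 2).

Definition dist x S : R := inf [set enorm (x - y) | y in S].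

(* Attouch-Wets pseudo-distance d_r^AW *)
Definition aw_dist (r : R) A B : \bar R :=
  ereal_sup [set `|dist z A - dist z B|%:E | z in [set z | enorm z <= r]].

End Euclidean_distance.

Section Lebesgue.
Context {R : realType}.

(* Carathéodory (not only Borel) measurable functions: the domain R carries the
   sigma-algebra of the completed Lebesgue measure. *)
Definition lebesgue_measurable_fun (D : set R) (g : R -> R) : Prop :=
  @measurable_fun _ _ (caratheodory_type ((wlength (@idfun R))^*)%mu) R D g.

Definition ae_from (t0 : R) (P : R -> Prop) : Prop :=
  \forall t \ae (@completed_lebesgue_measure R), t0 <= (t : R) -> P t.

Definition norm_from (t0 : R) (p : \bar R) (g : R -> R) : \bar R :=
  ('N[@completed_lebesgue_measure R]_p [EFin \o (g \_ `[t0, +oo[)])%E.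

Definition in_Lp_from (t0 : R) (p : \bar R) (g : R -> R) : Prop :=
  lebesgue_measurable_fun `[t0, +oo[ g /\ (norm_from t0 p g < +oo)%E.

Definition in_L1loc_from (t0 : R) (g : R -> R) : Prop :=
  forall T, t0 <= T ->
    (@completed_lebesgue_measure R).-integrable `[t0, T] (EFin \o g).

End Lebesgue.

(* On 'rV[R]_n the notions below are stated with the library norm and topology;
   all norms being equivalent, they do not depend on that choice. *)

Section Regularity.
Context {R : realType}.

(* s lists the endpoints (u.1, u.2) of finitely many pairwise nonoverlapping
   subintervals of [a, b]. *)
Definition abs_cont_on {V : normedModType R} (a b : R) (g : R -> V) : Prop :=
  forall e : R, 0 < e -> exists2 d : R, 0 < d &
    forall s : seq (R * R),
      (forall u, u \in s -> [/\ a <= u.1, u.1 <= u.2 & u.2 <= b]) ->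
      pairwise (fun u w => (u.2 <= w.1) || (w.2 <= u.1)) s ->
      \sum_(u <- s) (u.2 - u.1) < d ->
      \sum_(u <- s) `|g u.2 - g u.1| < e.

Definition loc_abs_cont_from {V : normedModType R} (t0 : R) (g : R -> V) : Prop :=
  forall a b, t0 <= a -> a <= b -> abs_cont_on a b g.

Definition locally_lipschitz {V W : normedModType R} (g : V -> W) : Prop :=
  forall x : V, exists2 U : set V, nbhs x U & [lipschitz g y | y in U].

End Regularity.

Section Dynamics.
Context {R : realType} {n : nat}.
Implicit Types f : R -> 'rV[R]_n -> 'rV[R]_n.

Definition is_solution f (t0 : R) (x : R -> 'rV[R]_n) : Prop :=
  loc_abs_cont_from t0 x /\
  ae_from t0 (fun t => is_derive t 1 x (f t (x t))).

Definition equilibria f (t : R) : set 'rV[R]_n := [set x | f t x = 0].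

Definition lyapunov (V1 V2 : R -> 'rV[R]_n -> R) (delta : R) :
    R -> 'rV[R]_n -> R :=
  fun t x => V1 t x + delta * V2 t x.

End Dynamics.

(* Main.v *)
(* Along the solution, w(t) = W(t, x(t)) satisfies w' <= -lambda w + g with
   g = c (vE + rho)^p <= lambda m (r/2)^p, and w(t0) <= m (r/2)^p; hence
   w <= m (r/2)^p at all times. As long as dist(x(t), E(t)) <= rbar this gives
   dist(x(t), E(t)) <= r/2, and since the distance is continuous in time (E
   moves at speed at most ||vE||_oo) it never leaves this region. Since vE and
   rho are in L^p, the set where g exceeds a given eta has small measure after a
   late time, hence lies in a small open set O. Off O, w decreases at a definite
   rate while w >= 2 eta / lambda, and on O it grows by at most a constant times
   the measure of O; thus w, and with it the distance, tends to 0.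

   The differential inequalities are integrated without the Lebesgue
   differentiation theorem: a gauge (Cousin) argument is combined with absolute
   continuity on an open cover of the exceptional null set. *)
Require Import Defs.
From HB Require Import structures.
From mathcomp Require Import all_boot all_order all_algebra.
From mathcomp Require Import all_classical all_reals all_analysis.
From mathcomp Require Import ess_sup_inf measurable_realfun.
From mathcomp Require Import ring lra.

Set Implicit Arguments.
Unset Strict Implicit.
Unset Printing Implicit Defensive.

Import Order.TTheory GRing.Theory Num.Theory.
Import numFieldNormedType.Exports.

Local Open Scope classical_set_scope.
Local Open Scope ring_scope.

(** * Covering tools and absolute continuity *)

(** Take [c] with [Q a c] close below the supremum of all such points. Concatenating with the local
    hypothesis at the supremum reaches strictly beyond it, unless [b] is hit first. *)
Lemma cousin (R : realType) (a b : R) (Q : R -> R -> Prop) : a <= b ->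
  (forall u c v, a <= u -> u <= c -> c <= v -> v <= b ->
    Q u c -> Q c v -> Q u v) ->
  (forall t, a <= t <= b -> exists2 d, 0 < d & forall u v,
    a <= u -> u <= t -> t <= v -> v <= b -> t - d < u -> v < t + d -> Q u v) ->
  Q a b.
Proof.
move=> ab Qcat Qloc.
pose S := [set c | a <= c <= b /\ Q a c].
have Sa : S a.
  split; first by rewrite lexx.
  have [|d d0 Qd] := Qloc a; first by rewrite lexx.
  by apply: Qd => //; rewrite ?ltrBlDr ?ltrDl.
have ubS : ubound S b by move=> c [/andP[]].
have supS : has_sup S by split; [exists a | exists b].
have [|d d0 Qd] := Qloc (sup S).
  by apply/andP; split; [apply: ub_le_sup => //; exists b | apply: ge_sup => //; exists a].
have [c [/andP[ac cb] Qac] ltc] := sup_adherent d0 supS.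
have cS : c <= sup S by apply: ub_le_sup; [exists b | split; rewrite ?ac].
have Sb : sup S <= b by apply: ge_sup; first exists a.
pose v := Num.min b (sup S + d / 2).
have Sv : sup S <= v by rewrite le_min Sb/= lerDl divr_ge0 ?ltW.
have vb : v <= b by rewrite ge_min lexx.
have Qav : Q a v.
  apply: (Qcat a c v) => //; first exact: le_trans Sv.
  apply: Qd => //.
  by rewrite gt_min; apply/orP; right; rewrite ltrD2l ltr_pdivrMr// ltr_pMr// ltr1n.
have vS : v <= sup S.
  apply: ub_le_sup; first by exists b.
  by split; rewrite ?vb ?andbT ?(le_trans _ Sv)// (le_trans ac).
have bd : b <= sup S + d / 2.
  rewrite leNgt; apply/negP => lt_b.
  by move: vS; rewrite /v (min_r (ltW lt_b)) gerDl leNgt divr_gt0.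
by move: Qav; rewrite /v (min_l bd).
Qed.

(** [phi t] is the measure of the part of [O] left of [t]. Its increments are additive over adjacent
    intervals, the form in which a Cousin argument can use the measure of [O]. *)
Lemma open_measure_primitive (R : realType) (O : set R) : open O ->
  (lebesgue_measure O < +oo)%E ->
  exists phi : R -> R, [/\ (forall u v, u <= v -> phi u <= phi v),
    (forall u v, phi v - phi u <= fine (lebesgue_measure O)) &
    (forall u v, u <= v -> `[u, v] `<=` O -> phi v - phi u = v - u)].
Proof.
move=> oO Ofin.
have mO : measurable (O : set (measurableTypeR R)) by exact: measurable_realfun.open_measurable.
have mOt t : measurable (O `&` `]-oo, t] : set (measurableTypeR R)).
  exact: measurableI.
have Ot t : (lebesgue_measure (O `&` `]-oo, t]) <= lebesgue_measure O)%E.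
  by apply: le_measure; rewrite ?inE//; exact: mOt.
have Otfin t : lebesgue_measure (O `&` `]-oo, t]) \is a fin_num.
  by rewrite ge0_fin_numE// (le_lt_trans (Ot t)).
have Ofn : lebesgue_measure O \is a fin_num by rewrite ge0_fin_numE.
exists (fun t => fine (lebesgue_measure (O `&` `]-oo, t]))); split.
- move=> u v uv; apply: fine_le => //.
  apply: le_measure; rewrite ?inE//; try exact: mOt.
  by apply: setIS => z /=; rewrite !in_itv/= => /le_trans; apply.
- move=> u v; rewrite lerBlDr (@le_trans _ _ (fine (lebesgue_measure O)))//.
    exact: fine_le.
  by rewrite lerDl fine_ge0.
- move=> u v uv uvO.
  have -> : O `&` `]-oo, v] = (O `&` `]-oo, u]) `|` `]u, v].
    apply/seteqP; split => z /=; rewrite !in_itv/=.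
      by move=> [Oz zv]; case: (leP z u) => zu; [left|right; rewrite ?zv].
    move=> [[Oz zu]|/andP[uz zv]]; first by split => //; exact: le_trans zu uv.
    by split => //; apply: uvO; rewrite /= in_itv/= zv ltW.
  have muv : lebesgue_measure (`]u, v] : set R) = (v - u)%:E.
    rewrite lebesgue_measure_itv/= lte_fin; case: ltP => // vu.
    by rewrite (@le_anti _ _ u v) ?uv ?subrr.
  rewrite measureU//=; last first.
    by apply/seteqP; split => // z/=; rewrite !in_itv/= => -[[_ zu] /andP[/lt_le_trans/(_ zu)]]; rewrite ltxx.
  by rewrite muv fineD// addrAC subrr add0r.
Qed.

(** Outer regularity, applied to a measurable null set containing [N]. *)
Lemma negligible_open_cover (R : realType) (N : set R) (e : R) :
  (@completed_lebesgue_measure R).-negligible N -> 0 < e ->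
  exists U, [/\ open U, N `<=` U & (lebesgue_measure U <= e%:E)%E].
Proof.
move=> [A [mA A0 NA]] e0.
have [U [oU AU Ue]] := @outer_measure_open_le R A e e0.
exists U; split => //; first exact: subset_trans AU.
by rewrite (le_trans Ue)// -[leRHS]add0e leeD2r// (_ : mu_ext _ _ = 0%E) //; exact: A0.
Qed.

Lemma abs_cont_on_addZ (R : realType) (a b c : R) (f g : R -> R) :
  abs_cont_on a b f -> abs_cont_on a b g ->
  abs_cont_on a b (fun t => f t + c * g t).
Proof.
move=> fac gac e e0.
have [|d1 d10 H1] := fac (e / 2); first by rewrite divr_gt0.
have c0 : 0 < `|c| + 1 by rewrite ltr_wpDl.
have [|d2 d20 H2] := gac (e / 2 / (`|c| + 1)); first by rewrite !divr_gt0.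
exists (Num.min d1 d2) => [|s sab spw]; first by rewrite lt_min d10.
rewrite lt_min => /andP[/(H1 _ sab spw) s1 /(H2 _ sab spw) s2].
have : \sum_(u <- s) `|f u.2 + c * g u.2 - (f u.1 + c * g u.1)| <=
    \sum_(u <- s) `|f u.2 - f u.1| + (`|c| + 1) * \sum_(u <- s) `|g u.2 - g u.1|.
  rewrite mulr_sumr -big_split/= ler_sum// => u _.
  rewrite (_ : _ - _ = (f u.2 - f u.1) + c * (g u.2 - g u.1)); last by ring.
  by rewrite (le_trans (ler_normD _ _))// lerD2l normrM ler_wpM2r// lerDl.
move/le_lt_trans; apply.
rewrite [ltRHS]splitr ltrD//.
by move: s2; rewrite ltr_pdivlMr// [X in X < _ -> _]mulrC.
Qed.

Lemma abs_cont_on_id (R : realType) (a b : R) : abs_cont_on a b (fun t : R => t).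
Proof.
move=> e e0; exists e => // s sab _; apply: le_lt_trans => /=.
rewrite big_seq [leRHS]big_seq ler_sum// => u /sab[_ uu _].
by rewrite ger0_norm// subr_ge0.
Qed.

Lemma abs_cont_on_continuous (R : realType) (V : normedModType R) (a b : R)
    (g : R -> V) (e : R) : abs_cont_on a b g -> 0 < e ->
  exists2 d, 0 < d & forall s t, a <= s <= b -> a <= t <= b -> `|s - t| < d ->
    `|g s - g t| < e.
Proof.
move=> gac e0; have [d d0 H] := gac e e0; exists d => // s t.
wlog st : s t / t <= s.
  move=> H0 sab tab; case: (leP t s) => [|/ltW] st; first exact: H0.
  by rewrite distrC (distrC (g s)); exact: H0.
move=> /andP[as_ sb] /andP[at_ tb]; rewrite ger0_norm ?subr_ge0// => std.
have := H [:: (t, s)]; rewrite !big_seq1/=; apply => //.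
by move=> u; rewrite inE => /eqP ->.
Qed.

(** * Integration of differential inequalities *)

(** Comparing [w u] and [w v] with [w t] costs errors [e * (t - u)] and [e * (v - t)], which add up
    to [e * (v - u)] because [t] lies between [u] and [v]. *)
Lemma derivable_straddle (R : realType) (w : R -> R) (t e : R) :
  derivable w t 1 -> 0 < e -> exists2 d, 0 < d & forall u v,
    u <= t -> t <= v -> t - d < u -> v < t + d ->
    w v - w u <= (derive1 w t + e) * (v - u).
Proof.
move=> dw e0; rewrite derive1E.
have /cvgrPdist_le/(_ e e0) : (h^-1 *: (w (h *: 1 + t) - w t)) @[h --> 0^'] --> 'D_1 w t.
  exact: dw.
move=> -[d /= d0 Hd]; exists d => //.
have step h : `|h| < d -> `|w (h + t) - w t - h * 'D_1 w t| <= e * `|h|.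
  move=> hd; have [->|h0] := eqVneq h 0.
    by rewrite add0r subrr mul0r subr0 normr0 mulr0.
  have := Hd h; rewrite /= sub0r normrN => /(_ hd h0).
  rewrite /GRing.scale/= mulr1 => H.
  rewrite (_ : _ - _ = - h * ('D_1 w t - h^-1 * (w (h + t) - w t))); last first.
    by field.
  by rewrite normrM normrN mulrC ler_wpM2r.
move=> u v ut tv du vd.
have hv : `|v - t| < d by rewrite ger0_norm ?subr_ge0//; lra.
have hu : `|u - t| < d by rewrite ler0_norm ?subr_le0//; lra.
have := step _ hv; have := step _ hu; rewrite !subrK.
rewrite (ler0_norm (x := u - t)) ?subr_le0// (ger0_norm (x := v - t)) ?subr_ge0//.
rewrite !ler_norml => /andP[h1 _] /andP[_ h2].
by move: h1 h2; set D := 'D_1 w t; lra.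
Qed.

Lemma abs_cont_growth (R : realType) (a b C : R) (w : R -> R) (O N : set R) :
  a <= b -> abs_cont_on a b w -> 0 <= C ->
  open O -> (lebesgue_measure O < +oo)%E ->
  (@completed_lebesgue_measure R).-negligible N ->
  (forall t, a <= t <= b -> ~ N t -> [/\ derivable w t 1,
    derive1 w t <= C & ~ O t -> derive1 w t <= 0]) ->
  w b - w a <= C * fine (lebesgue_measure O).
Proof.
move=> ab wac C0 oO Ofin N0 wder.
have [phi [phi_mono phi_le phi_O]] := open_measure_primitive oO Ofin.
suff: w b - w a <= C * (phi b - phi a).
  by move=> /le_trans; apply; rewrite ler_wpM2l.
apply/ler_addgt0Pl => e e0.
have ba : 0 < b - a + 1 by rewrite ltr_wpDl ?subr_ge0.
(* Half of [e] pays for the slope error [k] over all of [[a, b]], the other half for the variation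
   of [w] over intervals inside [U]. *)
pose k := e / 2 / (b - a + 1).
have k0 : 0 < k by rewrite !divr_gt0.
have kba : k * (b - a) <= e / 2.
  by rewrite /k -mulrA ler_piMr ?divr_ge0 ?ltW// mulrC ltr_pdivrMr// mul1r ltrDl.
have [|d d0 wd] := wac (e / 2); first by rewrite divr_gt0.
(* Measure [d / 2] keeps the total length of the family strictly below [d]. *)
have [|U [oU NU Ud]] := @negligible_open_cover R N (d / 2) N0; first by rewrite divr_gt0.
have Ufin : (lebesgue_measure U < +oo)%E by rewrite (le_lt_trans Ud) ?ltry.
have [psi [psi_mono psi_le psi_U]] := open_measure_primitive oU Ufin.
(* The increment of w over [u, v] is bounded by a small multiple of v - u, by the mass
   of O, and by the variation of w over a family of intervals inside U; this is
   additive in [u, v] and true around every point, so Cousin's lemma applies. *)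
pose Q u v := exists s : seq (R * R),
  [/\ (forall z, z \in s -> [/\ u <= z.1, z.1 <= z.2 & z.2 <= v]),
      pairwise (fun z y => (z.2 <= y.1) || (y.2 <= z.1)) s,
      \sum_(z <- s) (z.2 - z.1) <= psi v - psi u &
      w v - w u <= k * (v - u) + C * (phi v - phi u) +
        \sum_(z <- s) `|w z.2 - w z.1|].
suff [s [sab sd spsi sw]] : Q a b.
  have := wd s sab sd; rewrite (le_lt_trans spsi); last first.
    rewrite (le_lt_trans (psi_le _ _))// (@le_lt_trans _ _ (d / 2))//; last first.
      by rewrite ltr_pdivrMr// ltr_pMr// ltr1n.
    by rewrite -lee_fin fineK// ge0_fin_numE.
  move=> /(_ isT) se; apply: (le_trans sw); lra.
apply: cousin => // [u c v au uc cv vb|t tab].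
  move=> [s1 [s1i s1d s1p s1w]] [s2 [s2i s2d s2p s2w]].
  exists (s1 ++ s2); rewrite !big_cat/=; split; [| |lra|lra].
  - move=> z; rewrite mem_cat => /orP[/s1i[? ? /le_trans->]|/s2i[/(le_trans uc) ? ? ?]] //.
  - rewrite pairwise_cat s1d s2d !andbT; apply/allrelP => z y /s1i[_ _ zc] /s2i[cy _ _].
    by rewrite (le_trans zc cy).
(* At a point of [N] nothing is known about the derivative; a short interval around it lies in [U]
   and is itself the family. *)
have [Nt|Nt] := pselect (N t).
  have /nbhs_ballP[r /= r0 rU] := open_nbhs_nbhs (conj oU (NU _ Nt)).
  exists r => // u v au ut tv vb ru vr.
  have uv := le_trans ut tv.
  exists [:: (u, v)]; rewrite !big_seq1/=; split => //.
  - by move=> z; rewrite inE => /eqP ->.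
  - rewrite psi_U// => z /=; rewrite in_itv/= => /andP[uz zv].
    by apply: rU; rewrite /ball/= ltr_norml; apply/andP; split; lra.
  - rewrite (le_trans (ler_norm _))// lerDr.
    by rewrite addr_ge0// mulr_ge0 ?subr_ge0 ?phi_mono// ltW.
have [dw wC wO] := wder t tab Nt.
have [r r0 wr] := derivable_straddle dw k0.
(* Off [N] the family is empty, and it remains to compare the slope at [t] with [C] times the mass
   of [O]. *)
have main u v : u <= v -> derive1 w t * (v - u) <= C * (phi v - phi u) ->
    w v - w u <= (derive1 w t + k) * (v - u) -> Q u v.
  move=> uv h1 h2; exists [::]; rewrite !big_nil; split => //.
    by rewrite subr_ge0 psi_mono.
  by rewrite addr0 (le_trans h2)// mulrDl addrC lerD2l.
have [Ot|Ot] := pselect (O t).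
  have /nbhs_ballP[r' /= r'0 rO] := open_nbhs_nbhs (conj oO Ot).
  exists (Num.min r r'); first by rewrite lt_min r0.
  have : Num.min r r' <= r /\ Num.min r r' <= r' by rewrite !ge_min !lexx orbT.
  set r1 := Num.min _ _ => -[r1r r1r'] u v au ut tv vb ru vr.
  have uv := le_trans ut tv.
  apply: main => //; last by apply: wr => //; lra.
  rewrite phi_O// ?ler_wpM2r ?subr_ge0// => z /=; rewrite in_itv/= => /andP[uz zv].
  by apply: rO; rewrite /ball/= ltr_norml; apply/andP; split; lra.
exists r => // u v au ut tv vb ru vr.
have uv := le_trans ut tv.
apply: main => //; last exact: wr.
rewrite (@le_trans _ _ 0)//; first by rewrite mulr_le0_ge0 ?wO ?subr_ge0.
by rewrite mulr_ge0// subr_ge0 phi_mono.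
Qed.

Lemma abs_cont_onS (R : realType) (V : normedModType R) (a b a' b' : R)
    (w : R -> V) : a <= a' -> b' <= b -> abs_cont_on a b w -> abs_cont_on a' b' w.
Proof.
move=> aa' bb' wac e /wac[d d0 H]; exists d => // s sab; apply: H => u /sab[].
by move=> au uv ub; split => //; [exact: le_trans au | exact: le_trans bb'].
Qed.

(** Subtracting the line of slope [k] reduces this to [abs_cont_growth]. *)
Lemma abs_cont_growth_slope (R : realType) (a b k C : R) (w : R -> R)
    (O N : set R) :
  a <= b -> abs_cont_on a b w -> 0 <= C ->
  open O -> (lebesgue_measure O < +oo)%E ->
  (@completed_lebesgue_measure R).-negligible N ->
  (forall t, a <= t <= b -> ~ N t -> [/\ derivable w t 1,
    derive1 w t <= k + C & ~ O t -> derive1 w t <= k]) ->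
  w b - w a <= k * (b - a) + C * fine (lebesgue_measure O).
Proof.
move=> ab wac C0 oO Ofin N0 H.
have := @abs_cont_growth R a b C (fun t => w t + - k * t) O N ab
  (abs_cont_on_addZ _ wac (abs_cont_on_id _ _)) C0 oO Ofin N0.
have shift : w b + - k * b - (w a + - k * a) = w b - w a - k * (b - a) by ring.
rewrite shift lerBlDl; apply => t tab Nt; have [dw wC wO] := H t tab Nt.
have dk : is_derive t 1 (fun s => w s + - k * s) (derive1 w t - k).
  rewrite derive1E; have dw' := derivableP dw.
  apply: (is_derive_eq (is_deriveD dw' (is_deriveZ (- k) (is_derive_id t 1)))).
  by rewrite /GRing.scale/= mulr1.
rewrite derive1E (@derive_val _ _ _ _ _ _ _ dk); split => //.
- by rewrite lerBlDl.
- by move=> /wO; rewrite subr_le0.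
Qed.

(** [s] is the supremum of the times at which [w] is at most [B]; continuity shows that it is one of
    them. *)
Lemma last_crossing (R : realType) (a b B : R) (w : R -> R) :
  a <= b -> abs_cont_on a b w -> w a <= B -> B < w b ->
  exists s, [/\ a <= s <= b, w s <= B & forall t, s <= t <= b -> B <= w t].
Proof.
move=> ab wac waB Bwb; pose S := [set t | a <= t <= b /\ w t <= B].
have Sa : S a by rewrite /S/= lexx.
have ubS : has_ubound S by exists b => t [/andP[]].
have aS : a <= sup S by apply: ub_le_sup.
have Sb : sup S <= b by apply: ge_sup; [exists a | move=> t [/andP[]]].
have wS : w (sup S) <= B.
  rewrite leNgt; apply/negP => BwS.
  have [|d d0 H] := @abs_cont_on_continuous _ _ _ _ w (w (sup S) - B) wac.
    by rewrite subr_gt0.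
  have [|t [/andP[at_ tb] wt] tS] := sup_adherent d0 (conj _ ubS); first by exists a.
  have tS' : t <= sup S by apply: ub_le_sup => //; rewrite /S/= at_.
  have := H t (sup S); rewrite at_ tb aS Sb => /(_ isT isT).
  rewrite ltr_norml ltr_norml => H'.
  have : - d < t - sup S < d by apply/andP; split; lra.
  by move=> /H' /andP[]; lra.
have after t : sup S < t -> t <= b -> B < w t.
  move=> St tb; rewrite ltNge; apply/negP => wtB.
  have : t <= sup S by apply: ub_le_sup => //; rewrite /S/= tb (le_trans aS (ltW St)).
  by rewrite leNgt St.
exists (sup S); split => //; first by rewrite aS.
move=> t /andP[]; rewrite le_eqVlt => /orP[/eqP <- _|St tb]; last first.
  exact/ltW/after.
(* If [w] were below [B] at the supremum, it would stay so slightly to the right, where it is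
   already above [B]. There is room on the right since [B < w b]. *)
rewrite leNgt; apply/negP => wSB.
have [|d d0 H] := @abs_cont_on_continuous _ _ _ _ w (B - w (sup S)) wac.
  by rewrite subr_gt0.
have Sltb : sup S < b.
  by rewrite lt_neqAle Sb andbT; apply/eqP => SE; move: Bwb; rewrite -SE ltNge wS.
have : Num.min b (sup S + d / 2) <= b /\ Num.min b (sup S + d / 2) <= sup S + d / 2.
  by rewrite !ge_min !lexx orbT.
have : sup S < Num.min b (sup S + d / 2).
  by rewrite lt_min Sltb ltrDl divr_gt0.
set v := Num.min _ _ => Sv [vb vd].
have := H v (sup S); rewrite vb aS Sb (le_trans aS (ltW Sv)) => /(_ isT isT).
rewrite ltr_norml ltr_norml => H'.
have : - d < v - sup S < d by apply/andP; split; lra.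
by move=> /H' /andP[]; have := after v Sv vb; lra.
Qed.

(** After the last time at which [w] is at most [B], the derivative bounds hold off [N], so the
    growth estimate is started there. *)
Lemma abs_cont_comparison (R : realType) (a b B C : R) (w : R -> R)
    (O N : set R) :
  a <= b -> abs_cont_on a b w -> 0 <= C ->
  open O -> (lebesgue_measure O < +oo)%E ->
  (@completed_lebesgue_measure R).-negligible N ->
  (forall t, a <= t <= b -> ~ N t -> B <= w t -> [/\ derivable w t 1,
    derive1 w t <= C & ~ O t -> derive1 w t <= 0]) ->
  w a <= B -> w b <= B + C * fine (lebesgue_measure O).
Proof.
move=> ab wac C0 oO Ofin N0 H waB.
have [wbB|Bwb] := leP (w b) B.
  by rewrite (le_trans wbB)// lerDl mulr_ge0// fine_ge0.
have [s [/andP[as_ sb] wsB Bw]] := last_crossing ab wac waB Bwb.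
have := @abs_cont_growth R s b C w O N sb (abs_cont_onS as_ (lexx b) wac) C0 oO Ofin N0.
rewrite lerBlDl => /(_ _)/le_trans; apply; last by rewrite lerD2r.
move=> t /andP[st tb] Nt; apply: H => //; first by rewrite tb (le_trans as_).
by apply: Bw; rewrite st.
Qed.

(** Two phases: the decay first forces [w] down to [eta / 2] at some time [s]; afterwards the
    comparison at level [eta / 2] lets it grow by at most another [eta / 2]. *)
Lemma abs_cont_decay (R : realType) (t0 lam G : R) (w g : R -> R) (N : set R) :
  0 < lam -> 0 <= G -> loc_abs_cont_from t0 w ->
  (@completed_lebesgue_measure R).-negligible N ->
  (forall t, t0 <= t -> ~ N t -> [/\ derivable w t 1,
    derive1 w t <= - lam * w t + g t & g t <= G]) ->
  (forall eta e, 0 < eta -> 0 < e -> exists T O, [/\ t0 <= T, open O,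
    (lebesgue_measure O <= e%:E)%E & forall t, T <= t -> ~ O t -> g t <= eta]) ->
  forall eta, 0 < eta -> exists2 T, t0 <= T & forall t, T <= t -> w t <= eta.
Proof.
move=> lam0 G0 wac N0 wder small eta eta0.
(* Where [w] is at least [eta / 2], the term [- lam * w] is at most [- 2 * k], so a forcing of at
   most [k] leaves a slope of at most [- k]. *)
pose k := lam * eta / 4.
have k0 : 0 < k by rewrite divr_gt0// mulr_gt0.
have G1 : 0 < G + 1 by rewrite ltr_wpDl.
have [||T [U [T0 oU Ue gU]]] := small k (eta / 2 / (G + 1)) => //.
  by rewrite !divr_gt0.
have Ufin : (lebesgue_measure U < +oo)%E by rewrite (le_lt_trans Ue) ?ltry.
have GU : G * fine (lebesgue_measure U) <= eta / 2.
  have : fine (lebesgue_measure U) <= eta / 2 / (G + 1).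
    by rewrite -lee_fin fineK// ge0_fin_numE.
  by rewrite ler_pdivlMr//; have := @fine_ge0 R (lebesgue_measure U) (measure_ge0 _ _); lra.
(* At rate [k] this duration yields a drop of [|w T| + eta]. Even after a gain of [eta / 2] on [U],
   [w b] would be negative if [w] had stayed above [eta / 2]. *)
pose b := T + (`|w T| + eta) / k.
have Tb : T <= b by rewrite lerDl divr_ge0 ?addr_ge0// ltW.
have lamw t : eta / 2 <= w t -> - lam * w t <= - k - k.
  by rewrite /k -(ler_pM2l lam0); lra.
have rate t : T <= t -> ~ N t -> eta / 2 <= w t -> [/\ derivable w t 1,
    derive1 w t <= - k + G & ~ U t -> derive1 w t <= - k].
  move=> Tt Nt /lamw wt; have [dw w' gG] := wder t (le_trans T0 Tt) Nt.
  split => // [|/(gU _ Tt) gk]; rewrite (le_trans w')//; lra.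
have [s [Ts sb wsB]] : exists s, [/\ T <= s, s <= b & w s <= eta / 2].
  apply: contrapT => nex.
  have big t : T <= t -> t <= b -> eta / 2 < w t.
    by move=> Tt tb; rewrite ltNge; apply/negP => wt; apply: nex; exists t.
  have := @abs_cont_growth_slope R T b (- k) G w U N Tb (wac _ _ T0 Tb) G0 oU Ufin N0.
  have -> : - k * (b - T) = - (`|w T| + eta).
    by rewrite /b addrAC subrr add0r mulNr mulrCA divff ?mulr1// gt_eqF.
  have := big b Tb (lexx b); have := ler_norm (w T) => h1 h2 h3.
  suff : w b - w T <= - (`|w T| + eta) + G * fine (lebesgue_measure U) by lra.
  by apply: h3 => t /andP[Tt tb] Nt; apply: rate => //; exact/ltW/big.
exists b => [|t bt]; first exact: le_trans Tb.
have st := le_trans sb bt.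
have ts0 := le_trans T0 Ts.
have := @abs_cont_comparison R s t (eta / 2) G w U N st (wac _ _ ts0 st) G0 oU Ufin N0.
move=> /(_ _ wsB) h; suff : w t <= eta / 2 + G * fine (lebesgue_measure U) by lra.
apply: h => u /andP[su _] Nu wu.
have [dw w1 w2] := rate u (le_trans Ts su) Nu wu.
by split => // [|/w2 h]; lra.
Qed.

(** * Euclidean distance to a set *)

Lemma enorm_ge0 (R : realType) n (x : 'rV[R]_n) : 0 <= enorm x.
Proof. exact: sqrtr_ge0. Qed.

Lemma sqr_enorm (R : realType) n (x : 'rV[R]_n) :
  enorm x ^+ 2 = \sum_(j < n) x ord0 j ^+ 2.
Proof. by rewrite sqr_sqrtr// sumr_ge0// => j _; exact: sqr_ge0. Qed.

Lemma enormZ (R : realType) n (c : R) (x : 'rV[R]_n) :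
  enorm (c *: x) = `|c| * enorm x.
Proof.
rewrite /enorm -sqrtr_sqr -sqrtrM ?sqr_ge0// mulr_sumr.
by congr Num.sqrt; apply: eq_bigr => j _; rewrite mxE exprMn.
Qed.

Lemma enormN (R : realType) n (x : 'rV[R]_n) : enorm (- x) = enorm x.
Proof. by rewrite -scaleN1r enormZ normrN1 mul1r. Qed.

Lemma enorm_eq0 (R : realType) n (x : 'rV[R]_n) : enorm x = 0 -> x = 0.
Proof.
move=> x0; have := sqr_enorm x; rewrite x0 expr0n/= => /esym/eqP.
rewrite psumr_eq0 => [/allP x0'|j _]; last exact: sqr_ge0.
apply/rowP => j; rewrite mxE; apply/eqP.
by have := x0' j; rewrite mem_index_enum sqrf_eq0; apply.
Qed.

(** Expand the squared norm of [enorm y *: x - enorm x *: y] and divide by the product of the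
    norms. *)
Lemma row_cauchy_schwarz (R : realType) n (x y : 'rV[R]_n) :
  \sum_(j < n) x ord0 j * y ord0 j <= enorm x * enorm y.
Proof.
have [/enorm_eq0 ->|x0] := eqVneq (enorm x) 0.
  by rewrite big1 ?mulr_ge0 ?enorm_ge0// => j _; rewrite mxE mul0r.
have [/enorm_eq0 ->|y0] := eqVneq (enorm y) 0.
  by rewrite big1 ?mulr_ge0 ?enorm_ge0// => j _; rewrite mxE mulr0.
have xy0 : 0 < enorm x * enorm y by rewrite mulr_gt0// lt_def enorm_ge0 ?x0 ?y0.
have : 0 <= \sum_(j < n) (enorm y * x ord0 j - enorm x * y ord0 j) ^+ 2.
  by rewrite sumr_ge0// => j _; exact: sqr_ge0.
have -> : \sum_(j < n) (enorm y * x ord0 j - enorm x * y ord0 j) ^+ 2 =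
    enorm y ^+ 2 * (\sum_(j < n) x ord0 j ^+ 2) +
    enorm x ^+ 2 * (\sum_(j < n) y ord0 j ^+ 2) -
    2 * (enorm x * enorm y) * \sum_(j < n) x ord0 j * y ord0 j.
  rewrite !mulr_sumr -sumrN -!big_split/=; apply: eq_bigr => j _; ring.
rewrite -!sqr_enorm => h.
rewrite -(ler_pM2l xy0); lra.
Qed.

Lemma enormD (R : realType) n (x y : 'rV[R]_n) :
  enorm (x + y) <= enorm x + enorm y.
Proof.
rewrite -(@ler_pXn2r _ 2)// ?nnegrE ?addr_ge0 ?enorm_ge0// sqrrD !sqr_enorm.
have -> : \sum_(j < n) (x + y) ord0 j ^+ 2 = \sum_(j < n) x ord0 j ^+ 2 +
    \sum_(j < n) y ord0 j ^+ 2 + 2 * \sum_(j < n) x ord0 j * y ord0 j.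
  by rewrite mulr_sumr -!big_split/=; apply: eq_bigr => j _; rewrite mxE; ring.
by have := row_cauchy_schwarz x y; lra.
Qed.

(** Links Euclidean distances to the max norm in which the absolute continuity of a solution is
    expressed. *)
Lemma enorm_le_norm (R : realType) n (x : 'rV[R]_n) :
  enorm x <= Num.sqrt n%:R * `|x|.
Proof.
rewrite -(ger0_norm (normr_ge0 x)) -sqrtr_sqr -sqrtrM// ler_wsqrtr//.
rewrite mulr_natl -[X in _ *+ X]card_ord -sumr_const ler_sum// => j _.
rewrite -normr_id -[leLHS]real_normK ?num_real// ler_pXn2r ?nnegrE//.
by rewrite normr_id [leRHS]/Num.norm/= mx_normrE (le_bigmax _ _ (ord0, j)).
Qed.

Section dist_theory.
Context {R : realType} {n : nat}.
Implicit Types (x y : 'rV[R]_n) (S : set 'rV[R]_n).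

Let dist_lbound x S : has_lbound [set enorm (x - y) | y in S].
Proof. by exists 0 => _ [y _ <-]; exact: enorm_ge0. Qed.

Lemma dist_ge0 x S : S !=set0 -> 0 <= dist x S.
Proof.
move=> [y Sy]; apply: lb_le_inf; first by exists (enorm (x - y)), y.
by move=> _ [z _ <-]; exact: enorm_ge0.
Qed.

Lemma dist_le x y S : S y -> dist x S <= enorm (x - y).
Proof. by move=> Sy; apply: ge_inf => //; exists y. Qed.

Lemma dist_lt x S r : S !=set0 -> dist x S < r ->
  exists2 y, S y & enorm (x - y) < r.
Proof.
move=> [y Sy] /inf_lt[|_ [z Sz <-] zr]; last by exists z.
by exists (enorm (x - y)), y.
Qed.

Lemma dist_lipschitz x y S : S !=set0 -> dist x S <= enorm (x - y) + dist y S.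
Proof.
move=> S0; rewrite -lerBlDl; apply: lb_le_inf.
  by have [z Sz] := S0; exists (enorm (y - z)), z.
move=> _ [z Sz <-]; rewrite lerBlDl; apply: le_trans (enormD _ _).
by rewrite subrKA; exact: dist_le.
Qed.

(* The point at distance rho from an almost nearest point z of S, on the
   segment from z to x. *)
Lemma dist_intermediate x S rho : S !=set0 -> 0 < rho -> rho < dist x S ->
  exists y, 0 < dist y S <= rho.
Proof.
move=> S0 rho0 rhoD.
have [|z Sz zx] := @dist_lt x S (dist x S + rho) S0; first by rewrite ltrDl.
have Lx := dist_le x Sz.
have L0 : 0 < enorm (x - z) by lra.
pose s := rho / enorm (x - z).
have sL : s * enorm (x - z) = rho by rewrite divfK// gt_eqF.
have s0 : 0 <= s by rewrite divr_ge0// ltW.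
have s1 : s <= 1 by rewrite ler_pdivrMr// mul1r; lra.
exists (z + s *: (x - z)); apply/andP; split; last first.
  by apply: (le_trans (dist_le _ Sz)); rewrite addrAC subrr add0r enormZ ger0_norm// sL.
(* Positivity: the new point is at distance [enorm (x - z) - rho] from [x], which is less than
   [dist x S] by the choice of [z]. *)
have := @dist_lipschitz x (z + s *: (x - z)) S S0.
have -> : x - (z + s *: (x - z)) = (1 - s) *: (x - z).
  by rewrite scalerBl scale1r opprD addrA.
rewrite enormZ ger0_norm ?subr_ge0// mulrBl mul1r sL; lra.
Qed.

End dist_theory.

(** * Completed Lebesgue measure *)

Section Lebesgue_from.
Context {R : realType}.
Implicit Types g : R -> R.
Local Notation mu := (@completed_lebesgue_measure R).
Local Notation cR := (caratheodory_type ((wlength (@idfun R))^*)%mu).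

Lemma completed_measurable (A : set (measurableTypeR R)) : measurable A ->
  measurable (A : set cR).
Proof. exact: sub_caratheodory. Qed.

Lemma completed_itv_measurable (i : interval R) : measurable ([set` i] : set cR).
Proof. by apply: completed_measurable; exact: measurable_itv. Qed.

Lemma completed_itvcc (s t : R) : s <= t -> mu `[s, t] = (t - s)%:E.
Proof.
move=> st; have -> : mu `[s, t] = lebesgue_measure `[s, t] by [].
rewrite lebesgue_measure_itv/= lte_fin; case: ltP => // ts.
by rewrite (@le_anti _ _ s t) ?st ?subrr.
Qed.

(** The norm of exponent [+oo] unfolds to an essential supremum under the condition that the whole
    space has positive measure. *)
Lemma completed_setT_gt0 : (0 < mu setT)%E.
Proof.
apply: (@lt_le_trans _ _ (mu `[0, 1])).
  by rewrite completed_itvcc// subr0 lte_fin.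
by apply: le_measure; rewrite ?inE//; exact: completed_itv_measurable.
Qed.

Lemma Linfty_ae_le (t0 : R) g : (norm_from t0 +oo g < +oo)%E ->
  ae_from t0 (fun t => `|g t| <= fine (norm_from t0 +oo g)).
Proof.
move=> gfin.
have gE : norm_from t0 +oo g = ess_sup mu (abse \o (EFin \o (g \_ `[t0, +oo[))).
  by rewrite /norm_from unlock completed_setT_gt0.
have gfn : norm_from t0 +oo g \is a fin_num.
  by rewrite ge0_fin_numE// /norm_from Lnorm_ge0.
have := @ess_sup_ge _ _ _ mu (abse \o (EFin \o (g \_ `[t0, +oo[))).
rewrite -gE; apply: filterS => t /= + t0t.
by rewrite -[leRHS]fineK// lee_fin patchE mem_set//= in_itv/= t0t.
Qed.

Lemma integral_itv_le (g : R -> R) (K s t : R) : 0 <= K -> s <= t ->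
  mu.-integrable `[s, t] (EFin \o g) ->
  ae_from s (fun u => `|g u| <= K) ->
  (\int[mu]_(u in `[s, t]) (g u)%:E <= (K * (t - s))%:E)%E.
Proof.
move=> K0 st ig gK.
have mst := completed_itv_measurable `[s, t].
have mg := measurable_int _ ig.
apply: le_trans (lee_abs _) _.
apply: le_trans (le_abse_integral _ mst mg) _.
apply: (@le_trans _ _ (\int[mu]_(u in `[s, t]) K%:E)%E).
  apply: ae_ge0_le_integral => //.
    exact: measurableT_comp.
  move: gK; apply: negligibleS; apply: subsetC => u /= gK.
  by rewrite in_itv/= => /andP[/gK + _]; rewrite lee_fin.
by rewrite integral_cst// EFinM [X in (_ * X <= _)%E](completed_itvcc st).
Qed.

(** By Markov's inequality the superlevel set has finite measure; its parts beyond [t0 + k] decrease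
    to the empty set, so their measures tend to 0. *)
Lemma Lp_tail (t0 p : R) g (z e : R) : 0 < p -> in_Lp_from t0 p%:E g ->
  0 < z -> 0 < e ->
  exists2 T, t0 <= T & (mu [set t | (T <= t /\ z <= `|g t|)%R] <= e%:E)%E.
Proof.
move=> p0 [mg gfin] z0 e0.
pose f := EFin \o (g \_ `[t0, +oo[).
have mf : measurable_fun [set: cR] f.
  apply/measurable_EFinP.
  exact: (@measurable_restrictT _ _ cR R _ g (completed_itv_measurable `[t0, +oo[)).1.
have mA : measurable [set t : cR | (z%:E <= `|f t|)%E].
  rewrite -[X in measurable X]setTI.
  apply: emeasurable_fun_c_infty => //.
  exact: measurableT_comp.
pose F (k : nat) : set cR := [set t | t0 + k%:R <= t] `&` [set t | (z%:E <= `|f t|)%E].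
have mF k : measurable (F k).
  apply: measurableI => //.
  rewrite (_ : [set t | _] = [set` `[t0 + k%:R, +oo[]); last first.
    by apply/seteqP; split=> t /=; rewrite in_itv/= andbT.
  exact: completed_itv_measurable.
have FS (k l : nat) : (k <= l)%N -> F l `<=` F k.
  move=> kl t [/= lt zt]; split => //=.
  by rewrite (le_trans _ lt)// lerD2l ler_nat.
have F0 : (mu (F 0%N) < +oo)%E.
  have h : (z%:E `^ p * mu (setT `&` [set t : cR | z%:E <= `|f t|]) <=
      \int[mu]_x (`|f x| `^ p))%E.
    apply: (@le_integral_comp_abse _ _ _ mu setT measurableT f z (fun x => x `^ p)%E) => //.
    - exact: measurable_poweR.
    - by move=> r _; exact: poweR_ge0.
    - move=> x y; rewrite !inE/= !in_itv/= !andbT => x0 y0.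
      by apply: gt0_ler_poweR; rewrite ?in_itv/= ?leey ?andbT// ltW.
  rewrite setTI -poweR_Lnorm ?gt_eqF// in h.
  have {h} := le_lt_trans h (poweR_lty p gfin).
  have Foo : (mu (F 0%N) <= mu [set t : cR | (z%:E <= `|f t|)%E])%E.
    by apply: le_measure; rewrite ?inE// => t [].
  rewrite ltNge leye_eq => h; apply: (le_lt_trans Foo).
  rewrite ltNge leye_eq; apply: contra h => /eqP ->.
  by rewrite gt0_muley// lte_fin powR_gt0.
have capF : \bigcap_k F k = set0.
  apply/seteqP; split => // t Ft.
  have [/= + _] := Ft (Num.truncn (t - t0)).+1 I.
  by have := truncnS_gt (t - t0); lra.
have cvgF : mu \o F @ \oo --> (0%R)%:E.
  rewrite -[X in _ --> X](measure0 mu) -capF; apply: nonincreasing_cvg_mu => //.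
    by rewrite capF.
  by move=> k l kl; apply/subsetPset/FS.
have [[k1 _ Fk1] /cvgrPdist_le/(_ e e0)[k2 _ Fk2]] := (fine_cvgP _ _).1 cvgF.
pose k := maxn k1 k2.
exists (t0 + k%:R); first by rewrite lerDl.
have fE t : t0 + k%:R <= t -> (z%:E <= `|f t|)%E = (z <= `|g t|).
  move=> kt; rewrite /f/= patchE mem_set ?lee_fin//= in_itv/= andbT.
  by rewrite (le_trans _ kt)// lerDl.
rewrite (_ : [set t | _] = F k); last first.
  by apply/seteqP; split => t [/= kt zt]; split => //=; move: zt; rewrite fE.
rewrite -[X in (X <= _)%E]fineK; last by apply: Fk1; exact: leq_maxl.
rewrite lee_fin; have := Fk2 k (leq_maxr _ _).
by rewrite /= sub0r normrN => /(le_trans (ler_norm _)).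
Qed.
End Lebesgue_from.

(** * Distance to a moving set and smallness of the inputs *)

Lemma abs_cont_on_dominated (R : realType) (V : normedModType R)
    (a b A K : R) (x : R -> V) (d : R -> R) : 0 <= A -> 0 <= K ->
  (forall s t, a <= s -> s <= t -> t <= b ->
    `|d t - d s| <= A * `|x t - x s| + K * (t - s)) ->
  abs_cont_on a b x -> abs_cont_on a b d.
Proof.
move=> A0 K0 dx xac e e0.
have A1 : 0 < A + 1 by rewrite ltr_wpDl.
have K1 : 0 < K + 1 by rewrite ltr_wpDl.
have [|d1 d10 H1] := xac (e / 2 / (A + 1)); first by rewrite !divr_gt0.
exists (Num.min d1 (e / 2 / (K + 1))) => [|s sab spw].
  by rewrite lt_min d10 !divr_gt0.
rewrite lt_min => /andP[/(H1 _ sab spw)].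
rewrite !ltr_pdivlMr// => sx sK.
have : \sum_(u <- s) `|d u.2 - d u.1| <=
    A * \sum_(u <- s) `|x u.2 - x u.1| + K * \sum_(u <- s) (u.2 - u.1).
  rewrite !mulr_sumr -big_split/= big_seq [leRHS]big_seq ler_sum// => u /sab[au uu ub].
  exact: dx.
have : 0 <= \sum_(u <- s) `|x u.2 - x u.1| by rewrite sumr_ge0.
have : 0 <= \sum_(u <- s) (u.2 - u.1).
  by rewrite big_seq sumr_ge0// => u /sab[_ uu _]; rewrite subr_ge0.
lra.
Qed.

Lemma powR_le_inv (R : realType) (p a b : R) : 0 < p -> 0 <= a -> 0 <= b ->
  a `^ p <= b `^ p -> a <= b.
Proof.
move=> p0 a0 b0; apply: contraLR; rewrite -!ltNge => ab.
by rewrite gt0_ltr_powR.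
Qed.

Lemma ae_fromI (R : realType) (t0 : R) (P Q : R -> Prop) :
  ae_from t0 P -> ae_from t0 Q -> ae_from t0 (fun t => P t /\ Q t).
Proof.
move=> P0 Q0; apply: negligibleS (negligibleU P0 Q0).
rewrite -setCI; apply: subsetC => t [/= Pt Qt] t0t.
by split; [exact: Pt | exact: Qt].
Qed.

(* Absolute values make the bound hold everywhere off U, not only almost
   everywhere, when u and v are nonnegative only almost everywhere. *)
Lemma Lp_pair_small (R : realType) (t0 p c : R) (u v : R -> R) :
  0 < p -> 0 <= c -> in_Lp_from t0 p%:E u -> in_Lp_from t0 p%:E v ->
  forall eta e, 0 < eta -> 0 < e -> exists T U, [/\ t0 <= T, open U,
    (lebesgue_measure U <= e%:E)%E &
    forall t, T <= t -> ~ U t -> c * (`|u t| + `|v t|) `^ p <= eta].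
Proof.
move=> p0 c0 uLp vLp eta e eta0 e0.
have c1 : 0 < c + 1 by rewrite ltr_wpDl.
pose z := (eta / (c + 1)) `^ p^-1 / 2.
have z0 : 0 < z by rewrite divr_gt0// powR_gt0// divr_gt0.
have e4 : 0 < e / 4 by rewrite divr_gt0.
have cover (g : R -> R) : in_Lp_from t0 p%:E g -> exists T U, [/\ t0 <= T, open U,
    (lebesgue_measure U <= (e / 2)%:E)%E &
    forall t, T <= t -> ~ U t -> `|g t| <= z].
  move=> /Lp_tail-/(_ z (e / 4) p0 z0 e4)[T T0 mT].
  (* [e / 4] for the superlevel set and [e / 4] for the open enlargement; the two functions together
     use up [e]. *)
  have [U [oU TU Ue]] := @outer_measure_open_le R [set t | T <= t /\ z <= `|g t|] _ e4.
  exists T, U; split => //.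
    rewrite (le_trans Ue)// (_ : e / 2 = e / 4 + e / 4); last by lra.
    by rewrite EFinD leeD2r.
  by move=> t Tt Ut; rewrite leNgt; apply/negP => /ltW zg; apply: Ut; apply: TU.
have [T1 [U1 [T10 oU1 U1e H1]]] := cover u uLp.
have [T2 [U2 [T20 oU2 U2e H2]]] := cover v vLp.
exists (Num.max T1 T2), (U1 `|` U2); split.
- by rewrite le_max T10.
- exact: openU.
- apply: le_trans (_ : (lebesgue_measure U1 + lebesgue_measure U2 <= _)%E).
    by apply: measureU2; exact: open_measurable.
  by rewrite (_ : e = e / 2 + e / 2) ?EFinD ?leeD//; lra.
- move=> t; rewrite ge_max => /andP[/H1 uz /H2 vz] /not_orP[/uz {}uz /vz {}vz].
  have z2 : (z + z) `^ p = eta / (c + 1).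
    rewrite (_ : z + z = (eta / (c + 1)) `^ p^-1); last by rewrite /z; lra.
    by rewrite -powRrM mulVf ?gt_eqF// powRr1// divr_ge0// ltW.
  have : (`|u t| + `|v t|) `^ p <= eta / (c + 1).
    by rewrite -z2 ge0_ler_powR ?nnegrE ?addr_ge0 ?lerD// ltW.
  rewrite ler_pdivlMr//; have := powR_ge0 (`|u t| + `|v t|) p; lra.
Qed.

(** The radius [enorm z + 1] is positive and its ball contains [z]; the speed integral is the same
    for every radius, so the bound is uniform in [z]. *)
Lemma aw_dist_speed (R : realType) (n : nat) (t0 K : R)
    (E : R -> set 'rV[R]_n) (v : R -> R) (z : 'rV[R]_n) (s t : R) :
  in_L1loc_from t0 v -> 0 <= K -> ae_from t0 (fun u => `|v u| <= K) ->
  (forall r s t, 0 < r -> t0 <= s -> s <= t ->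
     (aw_dist r (E t) (E s) <=
      \int[@completed_lebesgue_measure R]_(tau in `[s, t]) (v tau)%:E)%E) ->
  t0 <= s -> s <= t -> `|dist z (E t) - dist z (E s)| <= K * (t - s).
Proof.
move=> v_loc K0 vK speed t0s st; rewrite -lee_fin.
have z1 : 0 < enorm z + 1 by rewrite ltr_wpDl ?enorm_ge0.
apply: le_trans (le_trans (speed _ s t z1 t0s st) _).
  by apply: ereal_sup_ubound; exists z => //=; rewrite lerDl.
apply: integral_itv_le => //.
  apply: integrableS (v_loc t (le_trans t0s st)); try exact: completed_itv_measurable.
  by move=> u /=; rewrite !in_itv/= => /andP[su ->]; rewrite (le_trans t0s).
move: vK; apply: negligibleS; apply: subsetC => u /= vu su.
exact/vu/(le_trans t0s).
Qed.

(** The intermediate value [dist (x s) (E t)] separates the motion of the point from that of the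
    set. *)
Lemma dist_moving_set (R : realType) (n : nat) (K s t : R)
    (E : R -> set 'rV[R]_n) (x : R -> 'rV[R]_n) :
  E t !=set0 -> (forall z, `|dist z (E t) - dist z (E s)| <= K * (t - s)) ->
  `|dist (x t) (E t) - dist (x s) (E s)| <=
    Num.sqrt n%:R * `|x t - x s| + K * (t - s).
Proof.
move=> E0 EK; rewrite -(subrKA (dist (x s) (E t))).
apply: (le_trans (ler_normD _ _)); apply: lerD; last exact: EK.
apply: le_trans (enorm_le_norm _).
have := dist_lipschitz (x t) (x s) E0; have := dist_lipschitz (x s) (x t) E0.
rewrite -(enormN (x s - x t)) opprB => h1 h2.
by rewrite ler_norml; apply/andP; split; lra.
Qed.

(** * Convergence of the distance to the equilibria *)

Theorem corollary4p11 (R : realType) (n : nat)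
  (* the system *)
  (t0 : R) (t0_ge0 : 0 <= t0)
  (f : R -> 'rV[R]_n -> 'rV[R]_n)
  (f_meas : forall x j,
     lebesgue_measurable_fun `[t0, +oo[ (fun t => f t x ord0 j))
  (f_lip : ae_from t0 (fun t => locally_lipschitz (f t)))
  (E_neq0 : forall t, t0 <= t -> equilibria f t !=set0)
  (E_closed : forall t, t0 <= t -> closed (equilibria f t))
  (* the equilibrium speed *)
  (vE : R -> R)
  (vE_loc : in_L1loc_from t0 vE)
  (vE_ge0 : ae_from t0 (fun t => 0 <= vE t))
  (vE_speed : forall r s t, 0 < r -> t0 <= s -> s <= t ->
     (aw_dist r (equilibria f t) (equilibria f s) <=
      \int[@completed_lebesgue_measure R]_(tau in `[s, t]) (vE tau)%:E)%E)
  (* the function W = V1 + delta V2 *)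
  (V1 V2 : R -> 'rV[R]_n -> R) (delta : R) (delta_gt0 : 0 < delta)
  (V1_ge0 : forall t x, 0 <= t -> 0 <= V1 t x)
  (V2_ge0 : forall t x, 0 <= t -> 0 <= V2 t x)
  (V1_ac : forall x, is_solution f t0 x ->
     loc_abs_cont_from t0 (fun t => V1 t (x t)))
  (V2_ac : forall x, is_solution f t0 x ->
     loc_abs_cont_from t0 (fun t => V2 t (x t)))
  (m M p rbar : R) (m_gt0 : 0 < m) (M_gt0 : 0 < M) (p_ge1 : 1 <= p)
  (rbar_gt0 : 0 < rbar)
  (W_bounds : forall t x, t0 <= t -> dist x (equilibria f t) <= rbar ->
     m * dist x (equilibria f t) `^ p <= lyapunov V1 V2 delta t x <=
     M * dist x (equilibria f t) `^ p)
  (* the solution and its differential inequality *)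
  (x : R -> 'rV[R]_n) (x_sol : is_solution f t0 x)
  (lambda c : R) (lambda_gt0 : 0 < lambda) (c_ge0 : 0 <= c)
  (rho : R -> R) (rho_ge0 : ae_from t0 (fun t => 0 <= rho t))
  (rho_Linfty : in_Lp_from t0 +oo%E rho)
  (vE_Linfty : in_Lp_from t0 +oo%E vE)
  (W_decay : ae_from t0 (fun t =>
     derivable (fun s => lyapunov V1 V2 delta s (x s)) t 1 /\
     derive1 (fun s => lyapunov V1 V2 delta s (x s)) t <=
       - lambda * lyapunov V1 V2 delta t (x t) + c * (vE t + rho t) `^ p))
  (* smallness *)
  (r : R) (r_gt0 : 0 < r) (r_le : r <= rbar)
  (input_small :
     (((c / (m * lambda)) `^ p^-1)%:E *
        (norm_from t0 +oo vE + norm_from t0 +oo rho) <= (r / 2)%:E)%E)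
  (init_small : dist (x t0) (equilibria f t0) < 2^-1 * (m / M) `^ p^-1 * r)
  (* integrability *)
  (vE_Lp : in_Lp_from t0 p%:E vE)
  (rho_Lp : in_Lp_from t0 p%:E rho) :
  dist (x t) (equilibria f t) @[t --> +oo] --> (0 : R).
Proof.
have p0 : 0 < p by exact: lt_le_trans ltr01 p_ge1.
have vfin := vE_Linfty.2; have rfin := rho_Linfty.2.
have vK := Linfty_ae_le vfin; have rK := Linfty_ae_le rfin.
move: input_small.
have /fineK <- : norm_from t0 +oo vE \is a fin_num.
  by rewrite ge0_fin_numE ?Lnorm_ge0.
have /fineK <- : norm_from t0 +oo rho \is a fin_num.
  by rewrite ge0_fin_numE ?Lnorm_ge0.
have : 0 <= fine (norm_from t0 +oo vE) by rewrite fine_ge0 ?Lnorm_ge0.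
have : 0 <= fine (norm_from t0 +oo rho) by rewrite fine_ge0 ?Lnorm_ge0.
move: vK rK; set Kv := fine (norm_from t0 +oo vE).
set Kr := fine (norm_from t0 +oo rho) => vK rK Kr0 Kv0.
rewrite -EFinD -EFinM lee_fin => small.
have K0 : 0 <= Kv + Kr by rewrite addr_ge0.
have ml0 : 0 < m * lambda by rewrite mulr_gt0.
have r20 : 0 < r / 2 by rewrite divr_gt0.
(* By the lower bound on [W], [w t <= B] gives [d t <= r / 2] as long as [d t <= rbar]. *)
pose B := m * (r / 2) `^ p.
(* The smallness condition raised to the power [p]. *)
have gB : c * (Kv + Kr) `^ p <= lambda * B.
  have : ((c / (m * lambda)) `^ p^-1 * (Kv + Kr)) `^ p <= (r / 2) `^ p.
    by rewrite ge0_ler_powR ?nnegrE ?mulr_ge0 ?powR_ge0// ltW.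
  rewrite powRM ?powR_ge0// -powRrM mulVf ?gt_eqF// powRr1; last first.
    by rewrite divr_ge0// ltW.
  by rewrite mulrAC ler_pdivrMr// /B; lra.
pose E t := equilibria f t.
pose d t := dist (x t) (E t).
pose w t := lyapunov V1 V2 delta t (x t).
have dE z s t : t0 <= s -> s <= t -> `|dist z (E t) - dist z (E s)| <= Kv * (t - s).
  by move=> t0s st; exact: (aw_dist_speed (t0 := t0) (v := vE)).
have d_ge0 t : t0 <= t -> 0 <= d t by move=> t0t; exact/dist_ge0/E_neq0.
have dac t : t0 <= t -> abs_cont_on t0 t d.
  move=> t0t; apply: (@abs_cont_on_dominated _ _ _ _ (Num.sqrt n%:R) Kv x) => //.
  - move=> u v t0u uv vt; apply: (@dist_moving_set _ _ Kv u v E x).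
      exact/E_neq0/(le_trans t0u).
    by move=> z; exact: dE.
  - exact: x_sol.1.
have wac : loc_abs_cont_from t0 w.
  by move=> a b ta ab; apply: abs_cont_on_addZ; [exact: V1_ac | exact: V2_ac].
pose g t := c * (`|vE t| + `|rho t|) `^ p.
have [N [N0 wN]] : exists N, (@completed_lebesgue_measure R).-negligible N /\
    forall t, t0 <= t -> ~ N t -> [/\ derivable w t 1,
      derive1 w t <= - lambda * w t + g t & g t <= lambda * B].
  have := ae_fromI (ae_fromI (ae_fromI vK rK) (ae_fromI vE_ge0 rho_ge0)) W_decay.
  set P := (X in ae_from _ X) => P0.
  exists (~` [set t | t0 <= t -> P t]); split; first exact: P0.
  move=> t t0t /contrapT/(_ t0t)[[[vt rt] [v0 r0]] [dw w']].
  split => //; first by rewrite /g (ger0_norm v0) (ger0_norm r0).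
  rewrite (le_trans _ gB)// /g ler_wpM2l// ge0_ler_powR ?nnegrE ?addr_ge0 ?lerD//.
  exact: ltW.
(* Otherwise some state lies at distance in (0, rbar], so m <= M there, and
   the initial smallness gives d t0 < r / 2. *)
have d0_le : d t0 <= rbar.
  rewrite leNgt; apply/negP => rd.
  have [y /andP[y0 yr]] := dist_intermediate (E_neq0 _ (lexx t0)) rbar_gt0 rd.
  have /andP[/le_trans/[apply]] := W_bounds _ _ (lexx t0) yr.
  rewrite ler_pM2r ?powR_gt0// => mM.
  have mM1 : m / M <= 1 by rewrite ler_pdivrMr// mul1r.
  have mM0 : 0 <= m / M by rewrite divr_ge0// ltW.
  have : (m / M) `^ p^-1 <= 1 `^ p^-1.
    by rewrite ge0_ler_powR ?nnegrE ?invr_ge0// ltW.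
  rewrite powR1.
  have := powR_ge0 (m / M) p^-1; move: init_small rd; rewrite -/(E t0) -/(d t0).
  have := r_le; nra.
(* The factor [m / M] produced by the initial condition turns the upper constant [M] into [m]. *)
have w0B : w t0 <= B.
  have /andP[_ /le_trans] := W_bounds _ _ (lexx t0) d0_le; apply.
  have : d t0 `^ p <= (2^-1 * (m / M) `^ p^-1 * r) `^ p.
    rewrite ge0_ler_powR ?nnegrE ?d_ge0 ?mulr_ge0 ?invr_ge0 ?powR_ge0//; exact: ltW.
  have mM0 : 0 <= m / M by rewrite divr_ge0// ltW.
  have -> : 2^-1 * (m / M) `^ p^-1 * r = r / 2 * (m / M) `^ p^-1 by ring.
  rewrite (powRM _ (ltW r20) (powR_ge0 _ _)) -powRrM mulVf ?gt_eqF// powRr1//.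
  by rewrite mulrA ler_pdivlMr// -/(d t0) /B mulrC (mulrC m).
(* Where [w] is at least [B], the damping outweighs the forcing, which is at most [lambda * B];
   hence the comparison applies with [C = 0] and [O] empty. *)
have wB t : t0 <= t -> w t <= B.
  move=> t0t.
  have := @abs_cont_comparison R t0 t B 0 w set0 N t0t (wac _ _ (lexx _) t0t)
    (lexx _) open0.
  rewrite measure0 /= mulr0 addr0 => /(_ (ltry _) N0); apply => //.
  move=> u /andP[t0u _] Nu Bw; have [dw w' gu] := wN u t0u Nu.
  have w'0 : derive1 w u <= 0.
    have : lambda * B <= lambda * w u by rewrite ler_pM2l.
    lra.
  by split.
have d_half t : t0 <= t -> d t <= rbar -> d t <= r / 2.
  move=> t0t dr; apply: (@powR_le_inv _ p) => //; [exact: d_ge0 | exact: ltW |].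
  have /andP[/le_trans/(_ (wB t t0t))] := W_bounds _ _ t0t dr.
  by rewrite /B ler_pM2l.
have r2r : r / 2 < r by lra.
(* d cannot cross the gap from r / 2 to r. *)
have d_rbar t : t0 <= t -> d t <= rbar.
  move=> t0t; rewrite leNgt; apply/negP => rd.
  have d0r : d t0 <= r by rewrite (le_trans (d_half _ _ d0_le))// ltW.
  have [s [/andP[t0s st] dsr rds]] :=
    last_crossing t0t (dac t t0t) d0r (le_lt_trans r_le rd).
  have := d_half s t0s (le_trans dsr r_le).
  by have := rds s; rewrite lexx st => /(_ isT); lra.
have lB0 : 0 <= lambda * B by rewrite !mulr_ge0 ?powR_ge0// ltW.
apply/cvgrPdist_le => e e0.
have [|T T0 wT] := abs_cont_decay lambda_gt0 lB0 wac N0 wN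
  (Lp_pair_small p0 c_ge0 vE_Lp rho_Lp) (eta := m * e `^ p).
  by rewrite mulr_gt0// powR_gt0.
exists T; split; first exact: num_real.
move=> t /ltW Tt; have t0t := le_trans T0 Tt.
rewrite /= sub0r normrN ger0_norm ?d_ge0//.
apply: (@powR_le_inv _ p) => //; [exact: d_ge0 | exact: ltW |].
have /andP[/le_trans/(_ (wT t Tt))] := W_bounds _ _ t0t (d_rbar t t0t).
by rewrite ler_pM2l.
Qed.
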